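(* Let $\sigma$ be well-behaved and let $\lambda^*$ be a stable configuration of $\sigma$-Bulgarian solitaire (with some number $n^*$ of cards). Total surplus and total deficit with respect to $\lambda^*$ may decrease but never increase during play: for every configuration $\lambda$ (with any number $n$ of cards), if $\lambda^{\mathrm{new}}$ denotes the configuration obtained from $\lambda$ by one move of $\sigma$-Bulgarian solitaire, then $$d^+_{\mathrm{tot}}(\lambda^{\mathrm{new}})\le d^+_{\mathrm{tot}}(\lambda)\quad\text{and}\quad d^-_{\mathrm{tot}}(\lambda^{\mathrm{new}})\le d^-_{\mathrm{tot}}(\lambda).$$
   Context: A configuration of $n$ cards is an integer partition $\lambda=(\lambda_1\ge\lambda_2\ge\cdots\ge\lambda_\ell>0)$ of $n$, extended by $\lambda_i=0$ for $i>\ell$. A function $\sigma$ from the positive integers to the nonnegative integers with $\sigma(h)\le h$ for all $h$ is well-behaved if $\sigma(1)=1$, $\sigma(h)$ is non-decreasing in $h$, and $h-\sigma(h)$ is non-decreasing in $h$. In a move of $\sigma$-Bulgarian solitaire, $\sigma(h)$ cards are picked from each nonempty pile of size $h$, all picked cards together form one new pile, and the resulting piles are sorted in weakly decreasing order (empty piles being discarded). A configuration is stable if a move leaves it unchanged. With respect to the fixed stable reference configuration $\lambda^*$, the total surplus and total deficit of $\lambda$ are $$d^+_{\mathrm{tot}}(\lambda)=\sum_{i\ge1}\max(\lambda_i-\lambda^*_i,0),\qquad d^-_{\mathrm{tot}}(\lambda)=\sum_{i\ge1}\max(\lambda^*_i-\lambda_i,0).$$ *)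

(* Defs.v *)
From mathcomp Require Import all_boot.

Set Implicit Arguments.
Unset Strict Implicit.
Unset Printing Implicit Defensive.

(* Piles are indexed from 0: [nth 0 l i] is lambda_(i+1), and the default
   value 0 is the extension lambda_i = 0 beyond the last part. *)
Definition is_config (n : nat) (l : seq nat) : bool :=
  [&& sorted geq l, all (fun h => 0 < h) l & sumn l == n].

(* The domain of sigma is the positive integers: the value [sigma 0] is never
   constrained, and never used on a configuration. *)
Definition picking_function (sigma : nat -> nat) : Prop :=
  forall h : nat, 0 < h -> sigma h <= h.

(* For a picking function the truncated [h - sigma h] is the true
   difference. *)
Definition well_behaved (sigma : nat -> nat) : Prop :=
  [/\ sigma 1 = 1,
      forall h k : nat, 0 < h -> h <= k -> sigma h <= sigma k
    & forall h k : nat, 0 < h -> h <= k -> h - sigma h <= k - sigma k].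

Definition move (sigma : nat -> nat) (l : seq nat) : seq nat :=
  let new_pile := sumn [seq sigma h | h <- l] in
  let old_piles := [seq h - sigma h | h <- l] in
  sort geq [seq h <- new_pile :: old_piles | 0 < h].

Definition stable (sigma : nat -> nat) (l : seq nat) : Prop :=
  move sigma l = l.

(* max(a - b, 0) is truncated subtraction, and all terms with index at least
   [maxn (size lstar) (size l)] of the infinite sums vanish. *)
Definition total_surplus (lstar l : seq nat) : nat :=
  \sum_(i < maxn (size lstar) (size l)) (nth 0 l i - nth 0 lstar i).

Definition total_deficit (lstar l : seq nat) : nat :=
  \sum_(i < maxn (size lstar) (size l)) (nth 0 lstar i - nth 0 l i).

(* Main.v *)
(** Partitions are compared pointwise.  A move is monotone for this order: each
    pile leaves a monotone remainder, the new pile is monotone, and sorting is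
    monotone because the i-th largest part is determined by counting the parts
    above each threshold.  Let J be the pointwise maximum of lambda and
    lambda*.  Then move J dominates both move lambda and
    move lambda* = lambda*, so |max (move lambda) lambda*| <= |move J| = |J|.
    The surplus of lambda is |J| - |lambda*| and its deficit is |J| - |lambda|,
    where |lambda| is preserved by the move. *)
Require Import Defs.
From mathcomp Require Import all_boot.

Definition ple (s t : seq nat) : Prop := forall i, nth 0 s i <= nth 0 t i.

Definition join (s t : seq nat) : seq nat :=
  mkseq (fun i => maxn (nth 0 s i) (nth 0 t i)) (maxn (size s) (size t)).

Lemma nth_join (s t : seq nat) (i : nat) :
  nth 0 (join s t) i = maxn (nth 0 s i) (nth 0 t i).
Proof.
have [lt_i | ge_i] := ltnP i (maxn (size s) (size t)).
  by rewrite nth_mkseq.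
rewrite nth_default ?size_mkseq //.
by move: ge_i; rewrite geq_max => /andP[ge_s ge_t]; rewrite !nth_default.
Qed.

Lemma join_gt0 (s t : seq nat) :
  all (leq 1) s -> all (leq 1) t -> all (leq 1) (join s t).
Proof.
move=> s_gt0 t_gt0; apply/(all_nthP 0) => i; rewrite size_mkseq nth_join.
by rewrite !leq_max => /orP[/(all_nthP 0 s_gt0)-> | /(all_nthP 0 t_gt0)->];
  rewrite ?orbT.
Qed.

Lemma sumn_nth_widen (s : seq nat) (n : nat) :
  size s <= n -> sumn s = \sum_(i < n) nth 0 s i.
Proof.
elim: s n => [|x s IHs] [|n] //=; first by rewrite big_ord0.
  by move=> _; rewrite big1 // => i _; rewrite nth_nil.
by rewrite ltnS big_ord_recl => /IHs->.
Qed.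

(** Positive entries force [s] to be no longer than [t], and keep the value [f 0] out of the
    comparison; surplus entries of [t] only add to the right-hand side. *)
Lemma ple_sumn_map (f : nat -> nat) (s t : seq nat) :
    (forall h k, 0 < h -> h <= k -> f h <= f k) ->
  all (leq 1) s -> ple s t -> sumn (map f s) <= sumn (map f t).
Proof.
move=> f_mono; elim: s t => [|x s IHs] [|y t] //= /andP[x_gt0 s_gt0] le_st.
  by have := leq_trans x_gt0 (le_st 0).
apply: leq_add; first exact: f_mono _ _ x_gt0 (le_st 0).
by apply: IHs => // i; apply: (le_st i.+1).
Qed.

Lemma ple_sumn (s t : seq nat) : ple s t -> sumn s <= sumn t.
Proof.
move=> le_st; rewrite (sumn_nth_widen _ _ (leq_maxl (size s) (size t))).
rewrite (sumn_nth_widen _ _ (leq_maxr (size s) (size t))).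
by apply: leq_sum => i _; apply: le_st.
Qed.

(** The parts at least [h] form a prefix of [s], whose length is the count. Positivity of [h]
    excludes the default value 0 past the end. *)
Lemma leq_nth_sorted (s : seq nat) (h i : nat) :
  sorted geq s -> 0 < h -> (h <= nth 0 s i) = (i < count (leq h) s).
Proof.
move=> s_sorted h_gt0; elim: s s_sorted i => [|x s IHs] xs_sorted i /=.
  by rewrite nth_nil leqNgt h_gt0.
have geq_trans : transitive geq by move=> y z t /= le_yz /leq_trans->.
move: xs_sorted => /= xs_path; have s_sorted := path_sorted xs_path.
have [le_hx | lt_xh] := leqP h x; first by case: i => [|i] //=; exact: IHs.
have s_le := order_path_min geq_trans xs_path.
(* The head is below [h], hence so is the whole tail: both sides are false. *)
have /eqP-> : count (leq h) s == 0.
  rewrite -leqn0 leqNgt -has_count; apply/hasPn => y /(allP s_le) /= le_yx.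
  by rewrite -ltnNge (leq_ltn_trans le_yx).
case: i => [|i] /=; first by rewrite leqNgt lt_xh.
apply: contraTF lt_xh => le_h; rewrite -leqNgt (leq_trans le_h) //.
have [lt_i | ge_i] := ltnP i (size s); last by rewrite nth_default.
exact: (allP s_le) (mem_nth 0 lt_i).
Qed.

Lemma ple_count (s t : seq nat) :
    sorted geq s -> sorted geq t ->
    (forall h, 0 < h -> count (leq h) s <= count (leq h) t) ->
  ple s t.
Proof.
move=> s_sorted t_sorted le_st i; have [-> // | h_gt0] := posnP (nth 0 s i).
(* The threshold is the part [nth 0 s i] itself. *)
rewrite leq_nth_sorted //; apply: leq_trans (le_st _ h_gt0).
by rewrite -leq_nth_sorted.
Qed.

Lemma move_sorted (sigma : nat -> nat) (s : seq nat) :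
  sorted geq (move sigma s).
Proof. by apply: sort_sorted => x y; apply: leq_total. Qed.

(** Counting ignores the sorting, and a positive threshold ignores the discarded empty piles.
    Writing the count as a sum over piles prepares it for [ple_sumn_map]. *)
Lemma count_move (sigma : nat -> nat) (s : seq nat) (h : nat) : 0 < h ->
  count (leq h) (move sigma s) =
    (h <= sumn (map sigma s)) + sumn [seq (h <= x - sigma x : nat) | x <- s].
Proof.
move=> h_gt0; rewrite /move (permP (permEl (perm_sort _ _))) count_filter.
rewrite (@eq_count _ _ (leq h)) => [|x /=]; last first.
  by rewrite andb_idr // => /(leq_trans h_gt0).
by rewrite /= count_map -sumn_count.
Qed.

Lemma sumn_move (sigma : nat -> nat) (s : seq nat) :
    picking_function sigma -> all (leq 1) s ->
  sumn (move sigma s) = sumn s.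
Proof.
move=> sigma_pick s_gt0; rewrite /move (perm_sumn (permEl (perm_sort _ _))).
have sumn_pos t : sumn [seq h <- t | 0 < h] = sumn t.
  by elim: t => //= -[|x] t IHt //=; rewrite IHt.
rewrite sumn_pos /=; elim: s s_gt0 => //= x s IHs /andP[x_gt0 /IHs <-].
by rewrite addnACA subnKC ?sigma_pick.
Qed.

Lemma ple_move (sigma : nat -> nat) (s t : seq nat) :
    well_behaved sigma -> all (leq 1) s -> ple s t ->
  ple (move sigma s) (move sigma t).
Proof.
move=> [_ sigma_mono rest_mono] s_gt0 le_st.
apply: ple_count => [||h h_gt0]; try exact: move_sorted.
have leq_threshold x y : x <= y -> (h <= x : nat) <= (h <= y).
  by case: (leqP h x) => // le_hx /(leq_trans le_hx)->.
(* [ple_sumn_map] serves twice: with [sigma] for the new pile, and with the 0/1 indicator of a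
   remainder reaching [h]. *)
rewrite !count_move // leq_add ?leq_threshold ?ple_sumn_map // => x y x_gt0 le_xy.
exact/leq_threshold/rest_mono.
Qed.

Lemma sumn_join (s t : seq nat) :
  sumn (join s t) =
    \sum_(i < maxn (size s) (size t)) maxn (nth 0 s i) (nth 0 t i).
Proof.
rewrite (sumn_nth_widen _ (maxn (size s) (size t))) ?size_mkseq //.
by apply: eq_bigr => i _; rewrite nth_join.
Qed.

(** Termwise, max(a, b) = a + (b - a) with truncated subtraction. *)
Lemma total_surplus_join (lstar l : seq nat) :
  sumn lstar + total_surplus lstar l = sumn (join lstar l).
Proof.
rewrite sumn_join (sumn_nth_widen _ _ (leq_maxl _ (size l))) -big_split /=.
by apply: eq_bigr => i _; rewrite -maxnE.
Qed.

Lemma total_deficit_join (lstar l : seq nat) :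
  sumn l + total_deficit lstar l = sumn (join lstar l).
Proof.
rewrite sumn_join (sumn_nth_widen _ _ (leq_maxr (size lstar) _)) -big_split /=.
by apply: eq_bigr => i _; rewrite -maxnE maxnC.
Qed.

Theorem theorem4 (sigma : nat -> nat) (nstar : nat) (lstar : seq nat)
    (sigma_pick : picking_function sigma)
    (sigma_wb : well_behaved sigma)
    (lstar_config : is_config nstar lstar)
    (lstar_stable : stable sigma lstar)
    (n : nat) (l : seq nat) (l_config : is_config n l) :
  total_surplus lstar (move sigma l) <= total_surplus lstar l /\
  total_deficit lstar (move sigma l) <= total_deficit lstar l.
Proof.
have /and3P[_ lstar_gt0 _] := lstar_config.
have /and3P[_ l_gt0 _] := l_config.
have le_join : sumn (join lstar (move sigma l)) <= sumn (join lstar l).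
  rewrite -(sumn_move _ _ sigma_pick (join_gt0 _ _ lstar_gt0 l_gt0)).
  (* By stability [lstar] is itself the result of a move, so [ple_move] bounds both arguments of the
     maximum. *)
  apply: ple_sumn => i; rewrite nth_join geq_max -{1}lstar_stable.
  by rewrite !ple_move // => j; rewrite nth_join leq_max leqnn ?orbT.
split.
  by rewrite -(leq_add2l (sumn lstar)) !total_surplus_join.
rewrite -(leq_add2l (sumn l)) total_deficit_join.
(* Conservation of cards makes the added term the sum of [move sigma l], as the identity after the
   move requires. *)
by rewrite -{1}(sumn_move _ _ sigma_pick l_gt0) total_deficit_join.
Qed.
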